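(* Let $\eta\in(1,\infty)$ and let $x(0),x(1),x(2),\ldots$ be a sequence of vectors in $\mathbb{R}^n$ satisfying $$x(k+1)=A(k,x(k))\,x(k),\qquad k=0,1,2,\ldots,$$ where the matrix-valued sequence $A(0,x(0)),A(1,x(1)),A(2,x(2)),\ldots$ is arbitrary, subject to $A(\cdot,\cdot)\in\mathbf{S}_{I_n}(\eta)$. Then, for every $x(0)$, $$\|x(0)\|_2\cdot\left(\frac{\eta-1}{\eta+1}\right)^{k/2}\ge\|x(k)\|_2,\qquad k=0,1,2,\ldots$$
   Context: For $\eta\in(1,\infty)$, $\mathbf{S}_{I_n}(\eta)=\{A\in\mathbb{C}^{n\times n}:\frac{\eta-1}{\eta+1}I_n-A^*A\succ 0\}$, where $\succ 0$ means positive definite. $\|\cdot\|_2$ is the Euclidean norm. *)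

(* Defs.v *)
From mathcomp Require Import all_boot all_order all_algebra.
From mathcomp Require Import all_classical reals exp.
From mathcomp Require Import complex.

Set Implicit Arguments.
Unset Strict Implicit.
Unset Printing Implicit Defensive.

Import Order.TTheory GRing.Theory Num.Theory.
Local Open Scope ring_scope.
Local Open Scope complex_scope.
Local Open Scope classical_set_scope.
Local Open Scope sesquilinear_scope.

(* In the order of a numClosedFieldType, [0 < z] means that z is a positive
   real number. *)
Definition posdefmx (C : numClosedFieldType) (n : nat) (M : 'M[C]_n) : Prop :=
  M \is hermsymmx /\
  forall v : 'cV[C]_n, v != 0 -> 0 < (v^t* *m M *m v) 0 0.

Definition S_I (R : realType) (n : nat) (eta : R) : set 'M[R[i]]_n :=
  [set A | posdefmx (((eta - 1) / (eta + 1))%:C *: 1%:M - A^t* *m A)].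

(* The norm that MathComp-Analysis puts on matrices is the maximum norm. *)
Definition norm2 (R : realType) (n : nat) (v : 'cV[R]_n) : R :=
  Num.sqrt (\sum_(i < n) v i 0 ^+ 2).

(* Main.v *)
Require Import Defs.
From mathcomp Require Import all_boot all_order all_algebra.
From mathcomp Require Import all_classical reals exp.
From mathcomp Require Import complex.

Import Order.TTheory GRing.Theory Num.Theory.
Local Open Scope ring_scope.
Local Open Scope sesquilinear_scope.

(** Put c = (eta - 1) / (eta + 1). Evaluating the positive definite matrix c I - A^* A at a vector v
    gives |Av|^2 <= c |v|^2, so each step of the recursion multiplies the norm by at most sqrt c
    ([norm2_mulmx_S_I]); induction on k then gives the bound. The matrices are complex and the
    states real, so [adjmx_mul_real_complex] links the Hermitian form to [norm2]. *)

Lemma ratio_ge0 (R : realType) (eta : R) :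
  1 < eta -> 0 <= (eta - 1) / (eta + 1).
Proof.
move=> heta; have eta0 := lt_trans ltr01 heta.
by rewrite divr_ge0 ?subr_ge0 ?addr_ge0 ?ltW.
Qed.

Lemma norm2_ge0 (R : realType) (n : nat) (v : 'cV[R]_n) : 0 <= norm2 v.
Proof. exact: sqrtr_ge0. Qed.

Lemma sqr_norm2 (R : realType) (n : nat) (v : 'cV[R]_n) :
  norm2 v ^+ 2 = \sum_(i < n) v i 0 ^+ 2.
Proof. by rewrite sqr_sqrtr // sumr_ge0 // => i _; rewrite sqr_ge0. Qed.

(** Conjugation fixes the entries of an embedded real vector, so its Hermitian square is a plain sum
    of squares. *)
Lemma adjmx_mul_real_complex (R : realType) (n : nat) (v : 'cV[R]_n) :
  ((map_mx (real_complex R) v)^t* *m map_mx (real_complex R) v) 0 0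
  = real_complex R (norm2 v ^+ 2).
Proof.
rewrite sqr_norm2 mxE rmorph_sum; apply: eq_bigr => i _.
by rewrite !mxE rmorphXn expr2 /= [Num.conj _]conjc_real.
Qed.

Lemma norm2_mulmx_S_I (R : realType) (n : nat) (eta : R) (heta : 1 < eta)
    (A : 'M[R[i]]_n) (v w : 'cV[R]_n) :
  S_I eta A -> map_mx (real_complex R) w = A *m map_mx (real_complex R) v ->
  norm2 w <= norm2 v * Num.sqrt ((eta - 1) / (eta + 1)).
Proof.
move=> [_ posA] wE; have c0 := ratio_ge0 _ _ heta.
rewrite -(@ler_pXn2r _ 2) // ?nnegrE ?mulr_ge0 ?norm2_ge0 ?sqrtr_ge0 //.
rewrite exprMn (sqr_sqrtr c0).
(* The squared inequality moves to [R[i]], where [posA] lives; the embedding reflects the order. *)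
suff: real_complex R (norm2 w ^+ 2)
      <= real_complex R (norm2 v ^+ 2 * ((eta - 1) / (eta + 1))) by rewrite lecR.
rewrite -adjmx_mul_real_complex wE (rmorphM _ (_ ^+ 2)) /= -adjmx_mul_real_complex.
(* [posA] covers nonzero vectors only; at zero both sides vanish. *)
have [->|v0] := eqVneq (map_mx (real_complex R) v) 0.
  by rewrite !mulmx0 mxE mul0r.
have /ltW := posA _ v0.
(* The form at v splits as c v^* v - (Av)^* (Av). *)
rewrite mulmxBr mulmxBl -scalemxAr mulmx1 -scalemxAl mxE [X in _ + X]mxE.
by rewrite subr_ge0 [X in _ <= X]mxE mulrC trmx_mul map_mxM !mulmxA.
Qed.

Theorem proposition4p2 (R : realType) (n : nat) (eta : R) (heta : 1 < eta)
    (A : nat -> 'cV[R]_n -> 'M[R[i]]_n) (x : nat -> 'cV[R]_n)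
    (hA : forall k : nat, S_I eta (A k (x k)))
    (hx : forall k : nat,
       map_mx (real_complex R) (x k.+1)
       = A k (x k) *m map_mx (real_complex R) (x k)) :
  forall k : nat,
    norm2 (x 0%N) * ((eta - 1) / (eta + 1)) `^ (k%:R / 2) >= norm2 (x k).
Proof.
move=> k; have c0 := ratio_ge0 _ _ heta.
(* Rewrite c^(k/2) as (sqrt c)^k, a natural power on which induction can run. *)
rewrite mulrC [k%:R / 2]mulrC powRrM powR12_sqrt // powR_mulrn ?sqrtr_ge0 //.
rewrite mulrC; elim: k => [|k IHk]; first by rewrite expr0 mulr1.
apply: le_trans (norm2_mulmx_S_I _ _ _ heta _ _ _ (hA k) (hx k)) _.
by rewrite exprSr mulrA ler_wpM2r ?sqrtr_ge0.
Qed.
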